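(* There is a function $c(d)$ depending only on $d$, doubly exponential in $d$ (namely $c(d)=2^{2^{O(d\log d)}}$), such that the following holds. Let $\|\cdot\|$ be an arbitrary norm on $\mathbb{R}^d$, let $X\subset\mathbb{R}^d$ be finite, and let $\mathcal{C}_1,\ldots,\mathcal{C}_{|X|}$ be the clusterings computed by the agglomerative complete linkage algorithm on input $X$ (with any tie-breaking). Then for all $k\in\mathbb{N}$ with $k\leq|X|$, \[\mathrm{diamcost}(\mathcal{C}_k)\leq c(d)\,(1+\log k)\cdot\mathrm{opt}_k,\] i.e. $\mathrm{diamcost}(\mathcal{C}_k)=O(\log k)\cdot\mathrm{opt}_k$, where $\mathrm{opt}_k$ is the minimum of $\mathrm{diamcost}(\mathcal{C})$ over all $k$-clusterings $\mathcal{C}$ of $X$.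
   Context: A $k$-clustering of a finite set $X$ is a partition of $X$ into $k$ non-empty sets (clusters). For finite non-empty $C\subset\mathbb{R}^d$, $\mathrm{diam}(C)=\max_{x,y\in C}\|x-y\|$, and $\mathrm{diamcost}(\mathcal{C})=\max_{C\in\mathcal{C}}\mathrm{diam}(C)$. The agglomerative complete linkage algorithm: start with $\mathcal{C}_{|X|}=\{\{x\}:x\in X\}$; for $i=|X|-1,\ldots,1$, choose distinct clusters $A,B\in\mathcal{C}_{i+1}$ minimizing $\mathrm{diam}(A\cup B)$ and set $\mathcal{C}_i=(\mathcal{C}_{i+1}\setminus\{A,B\})\cup\{A\cup B\}$; output $\mathcal{C}_1,\ldots,\mathcal{C}_{|X|}$. *)

(* Defs.v *)
From mathcomp Require Import all_boot all_order all_algebra.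
From mathcomp Require Import finmap.
From mathcomp Require Import all_classical all_reals all_analysis.

Set Implicit Arguments.
Unset Strict Implicit.
Unset Printing Implicit Defensive.

Import Order.TTheory GRing.Theory Num.Theory.

Local Open Scope classical_set_scope.
Local Open Scope fset_scope.
Local Open Scope ring_scope.

Record is_norm (R : realType) (d : nat) (N : 'rV[R]_d -> R) : Prop := IsNorm {
  is_norm_triangle : forall x y : 'rV[R]_d, N (x + y) <= N x + N y;
  is_norm_scale : forall (a : R) (x : 'rV[R]_d), N (a *: x) = `|a| * N x;
  is_norm_eq0 : forall x, N x = 0 -> x = 0 }.

Section Clustering.
Variables (R : realType) (d : nat) (N : 'rV[R]_d -> R).

(* Distances being nonnegative, the default value 0 of the two maxima below
   only matters for the empty set. *)
Definition diam (A : {fset 'rV[R]_d}) : R :=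
  \big[Num.max/0]_(x <- A) \big[Num.max/0]_(y <- A) N (x - y).

Definition diamcost (P : {fset {fset 'rV[R]_d}}) : R :=
  \big[Num.max/0]_(A <- P) diam A.

Definition is_clustering (X : {fset 'rV[R]_d}) (k : nat)
    (P : {fset {fset 'rV[R]_d}}) : Prop :=
  [/\ fcover P = X, trivIfset P, fset0 \notin P & #|` P| = k].

(* X has finitely many clusterings, so this infimum is a minimum as soon as
   X has a k-clustering, i.e. for 1 <= k <= #|X|; see opt_min. *)
Definition opt (X : {fset 'rV[R]_d}) (k : nat) : R :=
  inf [set diamcost P | P in [set P | is_clustering X k P]].

Definition merge_step (P Q : {fset {fset 'rV[R]_d}}) : Prop :=
  exists A B : {fset 'rV[R]_d},
    [/\ A \in P, B \in P, A != B,
        forall A' B' : {fset 'rV[R]_d}, A' \in P -> B' \in P -> A' != B' ->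
          diam (A `|` B) <= diam (A' `|` B')
      & Q = (A `|` B) |` (P `\` [fset A; B])].

(* The values of C outside 1, ..., #|X| are irrelevant.  Ties are broken
   arbitrarily: every sequence of admissible merges is a run. *)
Definition complete_linkage (X : {fset 'rV[R]_d})
    (C : nat -> {fset {fset 'rV[R]_d}}) : Prop :=
  C #|` X| = [fset [fset x] | x in X] /\
  forall i, (1 <= i < #|` X|)%N -> merge_step (C i.+1) (C i).

Lemma opt_min (X : {fset 'rV[R]_d}) (k : nat) P0 : is_clustering X k P0 ->
  exists P, [/\ is_clustering X k P, opt X k = diamcost P &
    forall Q, is_clustering X k Q -> diamcost P <= diamcost Q].
Proof.
move=> P0X.
have sub P : is_clustering X k P -> P \in fpowerset (fpowerset X).
  case=> <- _ _ _; rewrite fpowersetE; apply/fsubsetP => A AP.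
  rewrite fpowersetE; apply/fsubsetP => x xA.
  by apply/bigfcupP; exists A => //; rewrite AP.
pose T := fpowerset (fpowerset X).
have [/= P /asboolP PX Pmin] :=
  @arg_minP _ _ T [` sub _ P0X] (fun P => `[< is_clustering X k (val P) >])
    (fun P => diamcost (val P)) (asboolT P0X).
have lb Q : is_clustering X k Q -> diamcost (val P) <= diamcost Q.
  by move=> QX; apply: (Pmin [` sub _ QX]); apply/asboolP.
exists (val P); split=> //; apply/eqP; rewrite eq_le; apply/andP; split.
  apply: ge_inf; last by exists (val P).
  by exists (diamcost (val P)) => _ [Q QX <-]; apply: lb.
by apply: lb_le_inf; [exists (diamcost P0), P0 | move=> _ [Q QX <-]; apply: lb].
Qed.

End Clustering.

(* Main.v *)
(** Let [r = opt N X k], and for [t >= 0] freeze the run at the coarsest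
    clustering of cost at most [t].  There every cluster has diameter at most
    [t], while the union of any two clusters has diameter above [t].  So if
    the points carry labels such that clusters through equally labelled points
    could be merged at cost [t'], then between the times [t] and [t'] all but
    #(labels) of the clusters take part in a merge, and
    [2 * n(t') <= n(t) + #(labels)].

    Labelling a point by the trace of its cluster on a net of spacing
    [~ t / d], and iterating [d + 1] times whenever [t] doubles, bounds by a
    constant [K] of order [2^(d^O(d))] the number of clusters meeting a ball of
    radius [t] at time [t], at every scale [t].

    Now take an [r]-net [M] of [X]; it has at most [k] points.  Join net points
    at distance at most [Lam ~ K^2 r].  In a component with fewer than [K]
    points no cluster leaves the component before time [Lam], and labelling by
    the nearest net point halves the excess of clusters over net points until it
    vanishes.  In a component with at least [K] points, every ball of radius
    [K * Lam] contains [K] net points, which pay for the at most [K] clusters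
    meeting a ball of radius [s = 2 K Lam + r] at time [s].  Hence at time [s] at
    most [k] clusters are left.  This even gives a ratio independent of [k].

    Packing is obtained without volumes: among finitely many spanning vectors,
    a basis of maximal determinant gives all of them coordinates of absolute
    value at most 1, and a grid in these coordinates does the counting. *)
Require Import Defs.
From mathcomp Require Import all_boot all_order all_algebra.
From mathcomp Require Import finmap.
From mathcomp Require Import all_classical all_reals all_analysis.
(* Imported again because [all_classical] shadows [subsetP] and others. *)
From mathcomp Require Import fintype finset finmap zify lra ring.

Set Implicit Arguments.
Unset Strict Implicit.
Unset Printing Implicit Defensive.

Import Order.TTheory GRing.Theory Num.Theory.
Local Open Scope ring_scope.

(** * Counting images *)

(** On [A] the value of [f] determines that of [g], which induces a map from [f @: A] onto
    [g @: A]. *)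
Lemma leq_card_imset_factor (T L1 L2 : finType) (f : T -> L1) (g : T -> L2)
    (A : {set T}) :
  {in A &, forall x y, f x = f y -> g x = g y} -> (#|g @: A| <= #|f @: A|)%N.
Proof.
move=> fg; pose h l := omap g [pick x in A | f x == l].
have <- : #|Some @: (g @: A)| = #|g @: A| by apply: card_imset => ? ? [].
apply: leq_trans (leq_imset_card h (f @: A)).
apply/subset_leq_card/subsetP => _ /imsetP[_ /imsetP[x xA ->] ->].
apply/imsetP; exists (f x); first exact: imset_f.
rewrite /h; case: pickP => [y /andP[yA /eqP fyx] /=|/(_ x)].
  by rewrite (fg y x).
by rewrite xA eqxx.
Qed.

(** Read [f] as the finer partition and [g] as the coarser one. A class of [g] either contains two
    classes of [f] or is a single one, and [h] tells the classes of the latter kind apart. *)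
Lemma card_imset_halving (T L1 L2 L3 : finType) (f : T -> L1) (g : T -> L2)
    (h : T -> L3) (A : {set T}) :
  {in A &, forall x y, f x = f y -> g x = g y} ->
  {in [set x in A | [forall y in A, (g y == g x) ==> (f y == f x)]] &,
    forall x y, h x = h y -> g x = g y} ->
  (2 * #|g @: A| <= #|f @: A| + #|h @: A|)%N.
Proof.
move=> fg; set U := [set x in A | _] => hg.
have UA : U \subset A by apply/subsetP => x; rewrite inE => /andP[].
apply: (@leq_trans (#|f @: A| + #|g @: U|)); last first.
  rewrite leq_add2l; apply: leq_trans (leq_card_imset_factor hg) _.
  exact/subset_leq_card/imsetS.
(* [p] sends a class of [f] to the class of [g] around it; [inr tt] stands for labels not
   attained. *)
pose p (l : L1) : L2 + unit :=
  if [pick x in A | f x == l] is Some x then inl (g x) else inr tt.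
have pf x : x \in A -> p (f x) = inl (g x).
  move=> xA; rewrite /p; case: pickP => [y /andP[yA /eqP fyx]|/(_ x)].
    by rewrite (fg y x).
  by rewrite xA eqxx.
have -> : #|f @: A| = (\sum_(b in g @: A) #|[set a in f @: A | p a == inl b]|)%N.
  rewrite -sum1_card (partition_big (fun a => if p a is inl b then Some b else None)
    (fun b => b \in Some @: (g @: A))) /=; last first.
    by move=> _ /imsetP[x xA ->]; rewrite pf // !imset_f.
  rewrite big_imset /=; last by move=> ? ? _ _ [].
  apply: eq_bigr => b _; rewrite -sum1_card; apply: eq_bigl => a.
  by rewrite inE; case: (p a) => [c|u]; rewrite ?andbF.
have -> : #|g @: U| = (\sum_(b in g @: A) (b \in g @: U))%N.
  rewrite -sum1_card big_mkcond /= [RHS]big_mkcond /=; apply: eq_bigr => b _.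
  case: ifPn => [bU|_]; last by case: ifP.
  by rewrite (subsetP (imsetS g UA)).
(* Class by class: the number of [f]-classes inside, plus 1 if the class is unmerged, is at least
   2. *)
rewrite -big_split /= mulnC -sum_nat_const; apply: leq_sum => _ /imsetP[x xA ->].
case: (boolP (x \in U)) => xU.
  rewrite imset_f // addn1 ltnS card_gt0; apply/set0Pn; exists (f x).
  by rewrite inE imset_f //= pf.
apply: leq_trans (leq_addr _ _); move: xU; rewrite inE xA /= negb_forall_in.
case/exists_inP => y yA; rewrite negb_imply => /andP[/eqP gyx fyx].
rewrite cardE; apply: leq_trans (_ : size [:: f x; f y] <= _)%N => //.
apply: uniq_leq_size; first by rewrite /= inE eq_sym fyx.
move=> a; rewrite !inE => /orP[/eqP->|/eqP->];
  by rewrite mem_enum inE imset_f //= pf // ?gyx.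
Qed.

Lemma card_fibers (T L : finType) (f : T -> L) (A : {set T}) :
  #|A| = (\sum_(l in f @: A) #|[set x in A | f x == l]|)%N.
Proof.
rewrite -sum1_card (partition_big_imset f) /=; apply: eq_bigr => l _.
by rewrite -sum1_card; apply: eq_bigl => x; rewrite inE.
Qed.

Lemma leq_card_bigcup (I T : finType) (P : pred I) (F : I -> {set T}) :
  (#|\bigcup_(i | P i) F i| <= \sum_(i | P i) #|F i|)%N.
Proof.
elim/big_rec2: _ => [|i n A _ IH]; first by rewrite cards0.
by apply: leq_trans (leq_card_setU _ _) _; rewrite leq_add2l.
Qed.

(** Each step at least halves the excess [n j - u]. *)
Lemma halving_iter (n : nat -> nat) (u m : nat) :
  (forall j, (j < m)%N -> (2 * n j.+1 <= n j + u)%N) ->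
  (2 ^ m * n m <= n 0 + 2 ^ m * u)%N.
Proof.
elim: m n => [|m IH] n nu; first by rewrite !expn0 !mul1n leq_addr.
have := IH n (fun j jm => nu j (ltnW jm)); have := nu m (ltnSn m).
rewrite !expnS; move: (2 ^ m)%N (n m) (n m.+1) (n 0) => e a b c; nia.
Qed.

(** * Clusters near a ball *)

(* [cl t x] is the cluster of [x] in the coarsest clustering of the run whose
   clusters have diameter at most [t]. *)
Record linkage (R : realFieldType) (T : finType) (dist : T -> T -> R)
    (cl : R -> T -> {set T}) : Prop := Linkage {
  dist_xx : forall x, dist x x = 0;
  dist_sym : forall x y, dist x y = dist y x;
  dist_tri : forall y x z, dist x z <= dist x y + dist y z;
  cl_refl : forall t x, 0 <= t -> x \in cl t x;
  cl_eq : forall t x y, 0 <= t -> y \in cl t x -> cl t y = cl t x;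
  cl_diam : forall t x y, 0 <= t -> y \in cl t x -> dist x y <= t;
  cl_mono : forall t t' x, 0 <= t -> t <= t' -> cl t x \subset cl t' x;
  cl_stuck : forall t x y, 0 <= t ->
    (forall u v, u \in cl t x -> v \in cl t y -> dist u v <= t) ->
    cl t x = cl t y }.

Definition separated (R : realFieldType) (T : finType) (dist : T -> T -> R)
    (delta : R) (S : {set T}) : Prop :=
  {in S &, forall x y, x != y -> delta < dist x y}.

(** Besides the metric axioms, this is all that the counting uses of the geometry. *)
Definition packing (R : realFieldType) (T : finType) (dist : T -> T -> R)
    (a d : nat) : Prop :=
  forall (S : {set T}) (delta : R) (q : nat), 0 < delta -> (0 < q)%N ->
    {in S &, forall x y, dist x y <= q%:R * delta} ->
    separated dist delta S -> (#|S| <= (a * q) ^ d)%N.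

Section Linkage.
Variables (R : realFieldType) (T : finType) (dist : T -> T -> R).
Variable cl : R -> T -> {set T}.
Hypothesis L : linkage dist cl.

(** A maximal separated subset is a net: a point farther than [delta] from it could be added. *)
Lemma exists_net (A : {set T}) (delta : R) : 0 <= delta ->
  exists (M : {set T}) (z : T -> T), [/\ M \subset A, separated dist delta M &
    {in A, forall x, z x \in M /\ dist x (z x) <= delta}].
Proof.
move=> d0; pose P (M : {set T}) := (M \subset A) &&
  [forall x in M, forall y in M, (x != y) ==> (delta < dist x y)].
have P0 : P set0.
  by rewrite /P sub0set /=; apply/forall_inP => x; rewrite inE.
have [M /maxsetP[/andP[MA /forall_inP Msep] Mmax] _] := maxset_exists P0.
have sepM : separated dist delta M.
  by move=> x y xM yM xy; move/forall_inP: (Msep x xM) => /(_ y yM)/implyP; apply.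
have net x : x \in A -> exists2 m, m \in M & dist x m <= delta.
  move=> xA; case: (boolP [exists m in M, dist x m <= delta]) => [/exists_inP//|].
  rewrite negb_exists_in => /forall_inP far.
  have PxM : P (x |: M).
    rewrite /P subUset sub1set xA MA /=.
    apply/forall_inP => u; rewrite !inE => uM; apply/forall_inP => v.
    rewrite !inE => vM; apply/implyP => uv.
    case/orP: uM vM uv => [/eqP->|uM] /orP[/eqP->|vM] uv.
    - by rewrite eqxx in uv.
    - by rewrite ltNge far.
    - by rewrite (dist_sym L) ltNge far.
    - exact: sepM.
  have xM : x \in M by rewrite -(Mmax _ PxM (subsetUr _ _)) setU11.
  by exists x => //; rewrite (dist_xx L).
exists M, (fun x => odflt x [pick m in M | dist x m <= delta]); split=> // x xA.
case: pickP => [m /andP[]//|none]; have [m mM xm] := net x xA.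
by move: (none m); rewrite mM xm.
Qed.

Lemma cl_factor (t t' : R) (x y : T) : 0 <= t -> t <= t' ->
  cl t x = cl t y -> cl t' x = cl t' y.
Proof.
move=> t0 tt' xy; apply: (cl_eq L); first exact: le_trans tt'.
by apply: (subsetP (cl_mono L y t0 tt')); rewrite -xy (cl_refl L).
Qed.

(** A cluster at time [t'] that took part in no merge since [t] is also a cluster at time [t]; two
    of these with equal labels coincide by [cl_stuck]. As clusters stay inside [Z], no merge with
    outside points is overlooked. *)
Lemma cl_halving (L' : finType) (h : T -> L') (Z : {set T}) (t t' : R) :
  0 <= t -> t <= t' -> {in Z, forall x, cl t' x \subset Z} ->
  {in Z &, forall x y, h x = h y ->
    forall u v, u \in cl t x -> v \in cl t y -> dist u v <= t'} ->
  (2 * #|cl t' @: Z| <= #|cl t @: Z| + #|h @: Z|)%N.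
Proof.
move=> t0 tt' Zcl near; have t'0 := le_trans t0 tt'.
apply: card_imset_halving => [x y _ _|x y]; first exact: cl_factor.
have unmerged w : w \in [set x in Z | [forall y in Z,
    (cl t' y == cl t' x) ==> (cl t y == cl t x)]] ->
    w \in Z /\ {subset cl t' w <= cl t w}.
  rewrite inE => /andP[wZ /forall_inP wU]; split=> // u uw.
  have uZ : u \in Z by apply: (subsetP (Zcl w wZ)).
  by move: (wU u uZ); rewrite (cl_eq L t'0 uw) eqxx => /eqP <-; apply: cl_refl L _ _ t0.
case/unmerged => xZ xU /unmerged[yZ yU] hxy; apply: (cl_stuck L t'0) => u v ux vy.
by apply: (near x y) => //; [apply: xU | apply: yU].
Qed.

Variables (a d : nat).
Hypothesis pack : packing dist a d.

(** The trace of a cluster consists of net points within [t + 2 * delta] of [z x]; packing bounds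
    both the number of these and the number of choices for [z x]. *)
Lemma card_shapes (M Z : {set T}) (z : T -> T) (t delta : R) (p q : nat) :
  0 <= t -> 0 < delta -> (0 < p)%N -> (0 < q)%N -> separated dist delta M ->
  (forall x, z x \in M /\ dist x (z x) <= delta) ->
  {in Z &, forall x y, dist x y + 2 * delta <= p%:R * delta} ->
  2 * (t + 2 * delta) <= q%:R * delta ->
  (#|(fun x => z @: cl t x) @: Z| <= (a * p) ^ d * 2 ^ ((a * q) ^ d))%N.
Proof.
move=> t0 d0 p0 q0 sepM zM Zp tq.
pose near m := [set m' in M | dist m m' <= t + 2 * delta].
have sub (A : {set T}) : A \subset M -> separated dist delta A.
  by move=> /subsetP AM x y xA yA; apply: sepM; apply: AM.
apply: (@leq_trans #|\bigcup_(m in z @: Z) powerset (near m)|).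
  apply/subset_leq_card/subsetP => _ /imsetP[x xZ ->].
  apply/bigcupP; exists (z x); first exact: imset_f.
  rewrite powersetE; apply/subsetP => _ /imsetP[u ux ->].
  have [_ zx] := zM x; have [zuM zu] := zM u; rewrite inE zuM /=.
  have := cl_diam L t0 ux; have := dist_tri L x (z x) (z u).
  have := dist_tri L u x (z u); rewrite (dist_sym L (z x) x); lra.
apply: leq_trans (leq_card_bigcup _ _) _.
apply: (@leq_trans (\sum_(m in z @: Z) 2 ^ ((a * q) ^ d))).
  apply: leq_sum => m _; rewrite card_powerset leq_exp2l //.
  apply: (pack d0 q0); last by apply: sub; apply/subsetP => x; rewrite inE => /andP[].
  move=> x y; rewrite !inE => /andP[_ mx] /andP[_ my]; apply: le_trans tq.
  have := dist_tri L m x y; rewrite (dist_sym L x m); lra.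
rewrite sum_nat_const leq_mul2r; apply/orP; right.
apply: (pack d0 p0).
  move=> _ _ /imsetP[x xZ ->] /imsetP[y yZ ->].
  have [_ zx] := zM x; have [_ zy] := zM y; apply: le_trans (Zp x y xZ yZ).
  have := dist_tri L x (z x) (z y); have := dist_tri L y x (z y).
  rewrite (dist_sym L (z x) x); lra.
by apply: sub; apply/subsetP => _ /imsetP[x _ ->]; case: (zM x).
Qed.

(* The points whose cluster at time [t] is contained in [Y]: unlike the clusters
   meeting [Y], those contained in [Y] have all their ancestors in [Y]. *)
Definition core (Y : {set T}) (t : R) := [set x | cl t x \subset Y].

(** In units of the spacing [t0 / (2 * d.+1)] used below, [10 * d.+1] is [5 * t0] and [8 * d.+1] is
    [4 * t0], the roles of [p] and [q] in [card_shapes]. *)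
Definition shape_const : nat :=
  ((a * (10 * d.+1)) ^ d * 2 ^ ((a * (8 * d.+1)) ^ d))%N.

(** The gain [2 ^ d.+1] of [d.+1] halvings is twice the growth [2 ^ d] of the label count when the
    scale is halved, which lets the induction over scales close. *)
Lemma core_doubling (Y : {set T}) (t0 : R) (i : nat) : 0 < t0 ->
  {in Y &, forall x y, dist x y <= 4 * (2 ^+ i * t0)} ->
  (2 ^ d.+1 * #|cl (2 * t0) @: core Y (2 * t0)| <=
   #|cl t0 @: core Y t0| + 2 ^ d.+1 * (2 ^ (i * d) * shape_const))%N.
Proof.
(* [d.+1] steps of length [2 * delta] lead from [t0] to [2 * t0]. *)
move=> t0gt Ydiam; pose delta : R := t0 / (2 * d.+1%:R).
have D0 : 0 < d.+1%:R :> R by rewrite ltr0n.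
have delta0 : 0 < delta by rewrite divr_gt0 // mulr_gt0.
have t0E : t0 = 2 * d.+1%:R * delta.
  by rewrite /delta mulrC divfK // gt_eqF // mulr_gt0.
pose tt j : R := t0 + 2 * delta * j%:R.
have tt0 : tt 0 = t0 by rewrite /tt mulr0 addr0.
have ttd : tt d.+1 = 2 * t0 by rewrite /tt {2}t0E t0E; ring.
have [M [z [_ sepM zM]]] := exists_net setT (ltW delta0).
have {}zM x : z x \in M /\ dist x (z x) <= delta by apply: zM.
have := @halving_iter (fun j => #|cl (tt j) @: core Y (tt j)|)
  (2 ^ (i * d) * shape_const) d.+1; rewrite tt0 ttd; apply => j jd.
have jR : j.+1%:R <= d.+1%:R :> R by rewrite ler_nat.
have ttS : tt j.+1 = tt j + 2 * delta by rewrite /tt -natr1; ring.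
have ttj : t0 <= tt j.
  by rewrite /tt lerDl mulr_ge0 // mulr_ge0 // ltW.
have ttj0 : 0 <= tt j by apply: le_trans ttj; exact: ltW.
have ttj' : tt j <= tt j.+1 by rewrite ttS lerDl mulr_ge0 // ltW.
have tS : tt j.+1 <= 2 * t0.
  by rewrite -ttd /tt lerD2l ler_pM2l // mulr_gt0.
set Z := core Y (tt j.+1).
have ZY : {subset Z <= Y}.
  move=> x; rewrite inE => /subsetP; apply; apply: (cl_refl L).
  exact: le_trans ttj'.
apply: (@leq_trans (#|cl (tt j) @: Z| + #|(fun x => z @: cl (tt j) x) @: Z|)).
  apply: cl_halving => //.
    move=> x; rewrite inE => xY; apply/subsetP => y yx; rewrite inE.
    by rewrite (cl_eq L _ yx) //; exact: le_trans ttj'.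
  (* Equal traces give [v] a partner [w] in the cluster of [x] with the same net point, hence within
     [2 * delta] of [v]. *)
  move=> x y _ _ xy u v ux vy.
  have : z v \in z @: cl (tt j) x by rewrite xy imset_f.
  case/imsetP => w wx zvw; rewrite ttS.
  have := cl_diam L ttj0 ux; have := cl_diam L ttj0 wx => xw xu.
  have uw : dist u w <= tt j.
    by apply: (cl_diam L ttj0); rewrite (cl_eq L ttj0 ux).
  have [_ zv] := zM v; have [_ zw] := zM w.
  have := dist_tri L w u v; have := dist_tri L (z w) w v.
  rewrite -{2}zvw (dist_sym L (z v) v); lra.
apply: leq_add.
  apply/subset_leq_card/imsetS/subsetP => x; rewrite !inE; apply: subset_trans.
  exact: (cl_mono L).
have -> : (2 ^ (i * d) * shape_const =
    (a * (10 * d.+1 * 2 ^ i)) ^ d * 2 ^ ((a * (8 * d.+1)) ^ d))%N.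
  by rewrite [(a * (10 * _ * _))%N]mulnA [in RHS]expnMn -expnM /shape_const mulnCA mulnA.
apply: (card_shapes (z := z) (M := M) (delta := delta)) => //.
- by rewrite muln_gt0 expn_gt0.
- move=> x y xZ yZ; apply: le_trans (_ : 4 * (2 ^+ i * t0) + 2 * delta <= _).
    by rewrite lerD2r; apply: Ydiam; apply: ZY.
  have -> : (10 * d.+1 * 2 ^ i)%:R * delta = 5 * (2 ^+ i * t0).
    by rewrite t0E !natrM natrX; ring.
  have : 1 * t0 <= 2 ^+ i * t0 by rewrite ler_pM2r // exprn_ege1 // ler1n.
  have : delta * 1 <= delta * d.+1%:R by rewrite ler_pM2l // ler1n.
  rewrite t0E; nra.
- rewrite natrM -mulrA; have -> : 8%:R * (d.+1%:R * delta) = 4 * t0 by rewrite t0E; ring.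
  by move: tS; rewrite ttS; lra.
Qed.

Hypotheses (a_gt0 : (0 < a)%N) (d_gt0 : (0 < d)%N).

(** Clusters at time [s] meeting the ball lie in [Y]. At the times [s / 2 ^ i] the claim [bound] is
    trivial for large [i], where it exceeds the number of points, and [core_doubling] carries it
    down to [i = 0]. *)
Lemma card_near_clusters (s : R) (y : T) : 0 < s ->
  (#|cl s @: [set x | (dist y x <= s)%R]| <= 2 ^ d.+1 * shape_const)%N.
Proof.
move=> s0; pose Y := [set x | dist y x <= 2 * s].
have Ydiam : {in Y &, forall x x', dist x x' <= 4 * s}.
  move=> x x'; rewrite !inE => yx yx'; have := dist_tri L y x x'.
  rewrite (dist_sym L x y); lra.
pose tt i : R := s / 2 ^+ i.
have tt0 i : 0 < tt i by rewrite divr_gt0 // exprn_gt0.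
have ttS i : tt i = 2 * tt i.+1.
  by rewrite /tt exprS; field; rewrite expf_neq0 // pnatr_eq0.
have ttE i : s = 2 ^+ i * tt i by rewrite /tt mulrC divfK // expf_neq0 // pnatr_eq0.
pose n i := #|cl (tt i) @: core Y (tt i)|.
suff bound i : (n i <= 2 ^ d.+1 * shape_const * 2 ^ (i * d))%N.
  have := bound 0; rewrite mul0n expn0 muln1; apply: leq_trans.
  have -> : s = tt 0 by rewrite /tt expr0 divr1.
  apply/subset_leq_card/imsetS/subsetP => x; rewrite !inE => yx.
  apply/subsetP => u ux; rewrite inE; have := dist_tri L x y u.
  have := cl_diam L (ltW (tt0 0)) ux; move: yx; rewrite /tt expr0 divr1; lra.
have [I TI] : exists I, (#|T| <= 2 ^ (I * d))%N.
  exists #|T|; apply: ltnW; apply: leq_trans (ltn_expl _ (isT : 1 < 2)%N) _.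
  by rewrite leq_exp2l // leq_pmulr.
have sc0 : (0 < shape_const)%N.
  by rewrite muln_gt0 !expn_gt0 !muln_gt0 a_gt0.
have nI : (n I <= 2 ^ d.+1 * shape_const * 2 ^ (I * d))%N.
  apply: leq_trans (leq_imset_card _ _) _; apply: leq_trans (max_card _) _.
  apply: leq_trans TI _; rewrite leq_pmull // muln_gt0 expn_gt0 //.
case: (leqP I i) => [Ii|/ltnW iI].
  apply: leq_trans (leq_imset_card _ _) _; apply: leq_trans (max_card _) _.
  apply: leq_trans TI _; apply: (@leq_trans (2 ^ (i * d))).
    by rewrite leq_exp2l // leq_mul2r Ii orbT.
  by rewrite leq_pmull // muln_gt0 expn_gt0.
rewrite -(subKn iI); elim: (I - i)%N (leq_subr i I) => [|j IH] jI.
  by rewrite subn0.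
have -> : (I - j.+1 = (I - j).-1)%N by rewrite subnS.
have := IH (ltnW jI); have : (0 < I - j)%N by rewrite subn_gt0.
case: (I - j)%N => // m _ /= bm; have e0 : (0 < 2 ^ d.+1)%N by rewrite expn_gt0.
(* Both summands of [core_doubling] are at most [2 ^ d.+1 * shape_const * 2 ^ (m.+1 * d)], and twice
   this is [2 ^ d.+1] times the claimed bound. *)
rewrite -(leq_pmul2l e0); have := core_doubling (i := m.+1) (tt0 m.+1).
rewrite -ttE -ttS => /(_ Y Ydiam); rewrite -/(n m) -/(n m.+1).
rewrite !mulSn !expnD !expnS in bm *; move: bm.
move: (2 ^ d)%N (2 ^ (m * d))%N shape_const (n m) (n m.+1) => e f c n0 n1; lia.
Qed.

End Linkage.

(** * Comparing clusters with net points *)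

Section Counting.
Variables (R : realFieldType) (T : finType) (dist : T -> T -> R).
Variable cl : R -> T -> {set T}.
Hypothesis L : linkage dist cl.
Variables (K J : nat) (r : R) (M : {set T}) (z : T -> T).
Hypotheses (K_gt0 : (0 < K)%N) (KJ : (K * K < 2 ^ J)%N) (r_gt0 : 0 < r).
Hypothesis card_near : forall (s : R) y, 0 < s ->
  (#|cl s @: [set x | (dist y x <= s)%R]| <= K)%N.
Hypothesis zM : forall x, z x \in M /\ dist x (z x) <= r.

(** [Lam] leaves room for the times in [card_closed] plus two distances [r] to the net. In [s], the
    first term is twice the radius of the balls of [card_ball], the second the distance to the
    net. *)
Let Lam := 3 * 2 ^+ J * r.
Let s := 2 * K%:R * Lam + r.

Lemma Lam_gt0 : 0 < Lam.
Proof. by rewrite !mulr_gt0 // exprn_gt0. Qed.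

Let far_closed (Q : {set T}) :=
  {in Q & M, forall m m', dist m m' <= Lam -> m' \in Q}.

(** Points with the same net point are within [2 * r], so clusters through them at time [t] could be
    merged at cost [2 * t + 2 * r]. From at most [K * K] clusters at time [r], [J] halvings bring
    the excess over [#|Q|] below 1. *)
Lemma card_closed (Q : {set T}) : far_closed Q -> (#|Q| <= K)%N ->
  (#|cl s @: [set x | z x \in Q]| <= #|Q|)%N.
Proof.
move=> Qcl QK; set Z := [set x | _].
(* The solution of [tt j.+1 = 2 * tt j + 2 * r] with [tt 0 = r]. *)
pose tt j : R := (3 * 2 ^+ j - 2) * r.
have pow1 j : 1 <= 2 ^+ j :> R by rewrite exprn_ege1 // ler1n.
have tt0 j : 0 < tt j by rewrite /tt mulr_gt0 //; have := pow1 j; lra.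
have ttS j : tt j.+1 = 2 * tt j + 2 * r by rewrite /tt exprS; ring.
have ttJ j : (j <= J)%N -> tt j + 2 * r <= Lam.
  move=> jJ; have : 2 ^+ j <= 2 ^+ J :> R by rewrite ler_eXn2l // ltr1n.
  by move=> /(ler_wpM2r (ltW r_gt0)); rewrite /tt /Lam; lra.
have ttJs : tt J <= s.
  have := ttJ J (leqnn J); have := Lam_gt0.
  have : 1 <= K%:R :> R by rewrite ler1n.
  by move=> K1 L0; have := ler_wpM2r (ltW L0) K1; rewrite /s; have := r_gt0; lra.
have Zcl j : (j <= J)%N -> {in Z, forall x, cl (tt j) x \subset Z}.
  move=> jJ x; rewrite inE => xQ; apply/subsetP => y yx; rewrite inE.
  have [_ zx] := zM x; have [zyM zy] := zM y.
  apply: (Qcl (z x)) => //; apply: le_trans (ttJ j jJ).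
  have := cl_diam L (ltW (tt0 j)) yx; have := dist_tri L x (z x) (z y).
  have := dist_tri L y x (z y); rewrite (dist_sym L (z x) x); lra.
apply: (@leq_trans #|cl (tt J) @: Z|).
  by apply: leq_card_imset_factor => x y _ _; exact: (cl_factor L (ltW (tt0 J))).
have n0 : (#|cl (tt 0) @: Z| <= #|Q| * K)%N.
  have -> : tt 0 = r by rewrite /tt expr0; ring.
  apply: (@leq_trans #|\bigcup_(m in Q) (cl r @: [set x | (dist m x <= r)%R])|).
    apply/subset_leq_card/subsetP => _ /imsetP[x xZ ->]; rewrite inE in xZ.
    apply/bigcupP; exists (z x) => //; apply: imset_f.
    by rewrite inE (dist_sym L); case: (zM x).
  apply: leq_trans (leq_card_bigcup _ _) _; rewrite -sum_nat_const.
  by apply: leq_sum => m _; apply: card_near.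
have zZ : (#|z @: Z| <= #|Q|)%N.
  by apply/subset_leq_card/subsetP => _ /imsetP[x xZ ->]; rewrite inE in xZ.
have bound : (2 ^ J * #|cl (tt J) @: Z| <= #|cl (tt 0) @: Z| + 2 ^ J * #|Q|)%N.
  apply: (@halving_iter (fun j => #|cl (tt j) @: Z|)) => j jJ.
  apply: (@leq_trans (#|cl (tt j) @: Z| + #|z @: Z|)); last by rewrite leq_add2l.
  apply: (cl_halving L (ltW (tt0 j))).
  - by rewrite ttS; have := tt0 j; have := r_gt0; lra.
  - exact: Zcl.
  - move=> x y _ _ zxy u v ux vy; rewrite ttS.
    have := cl_diam L (ltW (tt0 j)) ux; have := cl_diam L (ltW (tt0 j)) vy.
    have [_ zx] := zM x; have [_ zy] := zM y; rewrite zxy in zx.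
    have := dist_tri L x u v; have := dist_tri L (z y) x v.
    have := dist_tri L y (z y) v.
    rewrite (dist_sym L (z y) y) (dist_sym L u x); lra.
rewrite -ltnS -(ltn_pmul2l (_ : 0 < 2 ^ J)%N) ?expn_gt0 //.
apply: leq_ltn_trans bound _; rewrite mulnS ltn_add2r.
apply: leq_ltn_trans n0 (leq_ltn_trans _ KJ).
by rewrite leq_mul2r QK orbT.
Qed.

Let e : rel T := [rel x y | [&& x \in M, y \in M & dist x y <= Lam]].
Let comp m := [set x | connect e m x].

Lemma linked_sym : connect_sym e.
Proof.
apply: sym_connect_sym => x y; rewrite /e /=.
by rewrite (dist_sym L) andbCA.
Qed.

Lemma comp_sub m : m \in M -> comp m \subset M.
Proof.
move=> mM; apply/subsetP => x; rewrite inE => mx.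
rewrite -(@closed_connect _ e (mem M) _ _ _ mx) //.
apply: (intro_closed linked_sym) => u v /and3P[_ vM _] _; exact: vM.
Qed.

Let ball m := [set x in comp m | dist m x <= K%:R * Lam].

(** Until the component is exhausted some edge leaves the ball, so enlarging the radius by [Lam]
    catches a new net point. *)
Lemma card_ball m : (K <= #|comp m|)%N -> (K <= #|ball m|)%N.
Proof.
move=> Kc; pose B (j : nat) := [set x in comp m | dist m x <= j%:R * Lam].
suff grow j : (j < #|B j|)%N \/ comp m \subset B j.
  case: (grow K) => [/ltnW//|sub]; apply: leq_trans Kc _.
  exact: subset_leq_card.
elim: j => [|j IH].
  left; rewrite card_gt0; apply/set0Pn; exists m.
  by rewrite !inE connect0 (dist_xx L) mul0r lexx.
have BS : B j \subset B j.+1.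
  apply/subsetP => x; rewrite !inE => /andP[-> /= mx].
  by apply: le_trans mx _; rewrite ler_wpM2r ?ler_nat // ltW // Lam_gt0.
case: IH => [Bj|sub]; last by right; apply: subset_trans sub BS.
case: (boolP (comp m \subset B j)) => [sub|nsub].
  by right; apply: subset_trans sub BS.
left; apply: leq_ltn_trans Bj _; apply: proper_card.
apply/properP; split=> //.
case: (boolP [exists x in B j, exists y, (y \notin B j) && e x y]) => [|closedB].
  case/exists_inP => x xB /existsP[y /andP[yB exy]]; exists y => //.
  move: xB; rewrite !inE => /andP[mx dx].
  rewrite (connect_trans mx (connect1 exy)) /=.
  have /and3P[_ _ xy] := exy; have := dist_tri L x m y.
  rewrite -natr1 mulrDl mul1r; lra.
case/negP: nsub; apply/subsetP => x; rewrite inE => mx.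
have <- : (m \in B j) = (x \in B j).
  apply: closed_connect mx; apply: (intro_closed linked_sym) => u v uv uB.
  apply: contraR closedB => vB; apply/exists_inP; exists u => //.
  by apply/existsP; exists v; rewrite vB.
by rewrite !inE connect0 (dist_xx L) mulr_ge0 // ltW // Lam_gt0.
Qed.

Let Big := [set m in M | (K <= #|comp m|)%N].

(** Around a [2 * (K%:R * Lam)]-separated net of [Big], the balls of radius [K%:R * Lam] are
    disjoint subsets of [Big] with at least [K] points each, and the balls of radius [s] meet all
    clusters counted, at most [K] each. *)
Lemma card_big : (#|cl s @: [set x | z x \in Big]| <= #|Big|)%N.
Proof.
have KL : 0 <= 2 * (K%:R * Lam) by have := mulr_ge0 (ler0n R K) (ltW Lam_gt0); lra.
have s0 : 0 < s by rewrite /s -mulrA ltr_wpDl.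
have [M' [z' [/subsetP M'B sepM' zM']]] := exists_net L Big KL.
apply: (@leq_trans #|\bigcup_(m in M') (cl s @: [set x | (dist m x <= s)%R])|).
  apply/subset_leq_card/subsetP => _ /imsetP[x xB ->]; rewrite inE in xB.
  have [z'M' zz'] := zM' _ xB; have [_ zx] := zM x.
  apply/bigcupP; exists (z' (z x)) => //; apply: imset_f; rewrite inE /s.
  have := dist_tri L (z x) (z' (z x)) x.
  rewrite (dist_sym L (z x) x) (dist_sym L _ (z x)) -mulrA; lra.
apply: leq_trans (leq_card_bigcup _ _) _.
apply: (@leq_trans (\sum_(m in M') #|ball m|)).
  apply: leq_sum => m mM'; apply: leq_trans (card_near _ s0) _.
  by apply: card_ball; have := M'B m mM'; rewrite inE => /andP[].
have ballB m : m \in Big -> ball m \subset Big.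
  rewrite inE => /andP[mM mK]; apply/subsetP => x; rewrite !inE => /andP[mx _].
  have -> : x \in M by apply: (subsetP (comp_sub mM)); rewrite inE.
  suff -> : comp x = comp m by [].
  by apply/setP => y; rewrite !inE; rewrite (same_connect linked_sym mx).
have -> : (\sum_(m in M') #|ball m| =
    \sum_(x in Big) #|[set m in M' | x \in ball m]|)%N.
  under eq_bigr do rewrite -sum1_card.
  under [RHS]eq_bigr do rewrite -sum1_card.
  rewrite (exchange_big_dep (mem Big)) /=; last first.
    by move=> m x mM' xm; apply: (subsetP (ballB m (M'B m mM'))).
  by apply: eq_bigr => x xB; apply: eq_bigl => m; rewrite inE.
rewrite -sum1_card; apply: leq_sum => x _; apply/card_le1_eqP => m m'.
rewrite !inE => /and3P[mM' _ mx] /and3P[mM'' _ mx'].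
apply/eqP; apply: contraT => mm'; have := sepM' _ _ mM'' mM' mm'.
rewrite ltNge; apply: contraNT => _.
have := dist_tri L x m' m; rewrite (dist_sym L x m); lra.
Qed.

(** Net points outside [Big] form whole components of fewer than [K] points, each named by its
    [root]; [card_closed] applies to every one. *)
Lemma card_small :
  (#|cl s @: [set x | z x \in M :\: Big]| <= #|M :\: Big|)%N.
Proof.
set S := M :\: Big.
pose Q m := [set x in S | fingraph.root e x == m].
rewrite (card_fibers (fingraph.root e) S).
apply: (@leq_trans
    #|\bigcup_(m in fingraph.root e @: S) (cl s @: [set x | z x \in Q m])|).
  apply/subset_leq_card/subsetP => _ /imsetP[x xS ->]; rewrite inE in xS.
  apply/bigcupP; exists (fingraph.root e (z x)); first exact: imset_f.
  by apply: imset_f; rewrite inE inE xS /=.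
apply: leq_trans (leq_card_bigcup _ _) _; apply: leq_sum => _ /imsetP[m mS ->].
move: mS; rewrite 2!inE => /andP[]; set Qm := Q _ => mB mM.
rewrite mM /= -ltnNge in mB; apply: card_closed.
  move=> x y; rewrite !inE => /andP[/andP[xB xM] /eqP xm] yM xy.
  have exy : connect e x y by apply: connect1; rewrite /e /= xM yM.
  rewrite yM /= -xm (eq_sym _ (fingraph.root e x)).
  rewrite (fingraph.root_connect linked_sym) exy !andbT /=.
  move: xB; rewrite xM /=.
  suff -> : comp y = comp x by [].
  by apply/setP => u; rewrite !inE (same_connect linked_sym exy).
apply: leq_trans (ltnW mB); apply/subset_leq_card/subsetP => x.
by rewrite !inE => /andP[_]; rewrite eq_sym (fingraph.root_connect linked_sym).
Qed.

Lemma card_clusters_le : (#|cl s @: setT| <= #|M|)%N.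
Proof.
have BM : Big \subset M by apply/subsetP => x; rewrite inE => /andP[].
rewrite -(cardsID Big M) (setIidPr BM).
apply: leq_trans (leq_add card_big card_small).
apply: leq_trans (leq_card_setU _ _); rewrite -imsetU.
apply/subset_leq_card/imsetS/subsetP => x _.
by have [zxM _] := zM x; rewrite inE !in_set zxM andbT; case: (_ <= _)%N.
Qed.

End Counting.

(** * Packing in a normed space *)

(** Cramer's rule: the cofactors of [B'] along row [i] involve only the rows shared with [B]. *)
Lemma cramer_row (F : fieldType) (d : nat) (B B' : 'M[F]_d) (w : 'rV_d) i :
  row' i B' = row' i B -> row i B' = w -> B \in unitmx ->
  (w *m invmx B) 0 i * \det B = \det B'.
Proof.
move=> B'B B'w uB; rewrite /invmx uB -scalemxAr mxE mulrC mulrA divff; last first.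
  by move: uB; rewrite unitmxE unitfE.
rewrite mul1r mxE (expand_det_row _ i); apply: eq_bigr => j _.
rewrite -B'w !mxE /cofactor; congr (_ * (_ * \det _)).
have /matrixP E := B'B; apply/matrixP => k l.
by have := E k (lift j l); rewrite !mxE => ->.
Qed.

(** Take the rows of [B] among the [D u] with maximal absolute determinant: by Cramer's rule, a
    coordinate of absolute value above 1 would let a row exchange increase it. *)
Lemma finite_auerbach (F : realFieldType) (d : nat) (U : finType)
    (D : U -> 'rV[F]_d) (b0 : {ffun 'I_d -> U}) :
  \det (\matrix_i D (b0 i)) != 0 ->
  exists B : 'M[F]_d, [/\ B \in unitmx, forall i, exists u, row i B = D u &
    forall u i, `|(D u *m invmx B) 0 i| <= 1].
Proof.
move=> det0; pose mat (b : {ffun 'I_d -> U}) := \matrix_i D (b i).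
have [b _ bmax] := @Order.TotalTheory.arg_maxP _ _ _ b0 xpredT
  (fun b => `|\det (mat b)|) isT.
have detb : 0 < `|\det (mat b)|.
  by apply: lt_le_trans (bmax b0 isT); rewrite normr_gt0.
have uB : mat b \in unitmx by rewrite unitmxE unitfE -normr_gt0.
exists (mat b); split=> // [i|u i]; first by exists (b i); rewrite rowK.
pose b' := [ffun j => if j == i then u else b j].
rewrite -(ler_pM2r detb) mul1r -normrM (cramer_row (B' := mat b')) //.
- exact: bmax.
- by apply/matrixP => k l; rewrite !mxE ffunE eq_sym (negPf (neq_lift _ _)).
- by rewrite rowK ffunE eqxx.
Qed.

Section NormPacking.
Variables (R : realType) (d : nat) (N : 'rV[R]_d -> R).
Hypothesis normN : is_norm N.

Lemma is_norm0 : N 0 = 0.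
Proof. by rewrite -(scale0r 0) (is_norm_scale normN) normr0 mul0r. Qed.

Lemma is_norm_opp x : N (- x) = N x.
Proof. by rewrite -scaleN1r (is_norm_scale normN) normrN1 mul1r. Qed.

Lemma is_norm_ge0 x : 0 <= N x.
Proof.
have := is_norm_triangle normN x (- x); rewrite subrr is_norm0 is_norm_opp; lra.
Qed.

Lemma is_norm_sum (I : finType) (f : I -> 'rV[R]_d) :
  N (\sum_i f i) <= \sum_i N (f i).
Proof.
elim/big_rec2: _ => [|i y x _ IH]; first by rewrite is_norm0.
by apply: le_trans (is_norm_triangle normN _ _) _; rewrite lerD2l.
Qed.

(** In a basis of vectors of norm at most [q%:R * delta], the translated set has coordinates in
    [[-1, 1]]. Two points in a grid cell of side [1 / (d * q)] are at most [delta] apart, hence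
    equal, and there are [(2 * d * q + 1) ^ d] cells. *)
Lemma norm_packing (T : finType) (v : T -> 'rV[R]_d) : (0 < d)%N ->
  packing (fun x y => N (v x - v y)) (3 * d) d.
Proof.
move=> d0 S delta q delta0 q0 Sq sepS.
have [->|[x0 x0S]] := set_0Vmem S; first by rewrite cards0.
have q0R : 0 < q%:R :> R by rewrite ltr0n.
have d0R : 0 < d%:R :> R by rewrite ltr0n.
pose rho := q%:R * delta; have rho0 : 0 < rho by rewrite mulr_gt0.
pose w := 1 + \sum_i N (delta_mx 0 i).
have w0 : 0 < w by rewrite ltr_pwDl // sumr_ge0 // => i _; exact: is_norm_ge0.
(* The differences need not span, so multiples of the unit vectors are added, scaled by [w] to norm
   at most [rho]. *)
pose D (u : T + 'I_d) : 'rV[R]_d := match u with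
  | inl x => if x \in S then v x - v x0 else 0
  | inr i => (rho / w) *: delta_mx 0 i end.
have Drho u : N (D u) <= rho.
  case: u => [x|i] /=.
    by case: ifP => xS; [exact: Sq | rewrite is_norm0 ltW].
  rewrite (is_norm_scale normN) gtr0_norm ?divr_gt0 //.
  rewrite mulrAC ler_pdivrMr // ler_pM2l // /w (bigD1 i) //=.
  have : 0 <= \sum_(j | j != i) N (delta_mx 0 j).
    by apply: sumr_ge0 => j _; exact: is_norm_ge0.
  by have := is_norm_ge0 (delta_mx 0 i); lra.
have [|B [uB Brow Bcoord]] := @finite_auerbach _ _ _ D [ffun i => inr i].
  have -> : \matrix_i D ([ffun i => inr i] i) = (rho / w)%:M.
    apply/matrixP => i j; rewrite !mxE ffunE /= !mxE eqxx /=.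
    by rewrite eq_sym mulr_natr.
  by rewrite det_scalar expf_neq0 // gt_eqF // divr_gt0.
pose c x i : R := ((v x - v x0) *m invmx B) 0 i.
have c1 x i : x \in S -> `|c x i| <= 1.
  by move=> xS; have := Bcoord (inl x) i; rewrite /= xS.
(* The coordinate 1 itself falls into cell [2 * d * q], hence [n.+1] cells per axis. *)
pose n := (2 * d * q)%N.
pose cell x : {ffun 'I_d -> 'I_n.+1} :=
  [ffun i => inord (Num.truncn ((c x i + 1) * (d * q)%:R))].
have dq0 : 0 < (d * q)%:R :> R by rewrite ltr0n muln_gt0 d0.
have cellP x i : x \in S ->
    (cell x i)%:R <= (c x i + 1) * (d * q)%:R < (cell x i)%:R + 1.
  move=> /(c1 x i); rewrite ler_norml => /andP[c1l c1r].
  have pos : 0 <= (c x i + 1) * (d * q)%:R by apply: mulr_ge0; [lra|exact: ltW].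
  rewrite ffunE inordK; last first.
    rewrite ltnS -(ler_nat R); apply: le_trans (_ : (c x i + 1) * (d * q)%:R <= _).
      by case/andP: (truncn_itv pos).
    by rewrite /n -mulnA [leRHS]natrM ler_wpM2r ?(ltW dq0) //; lra.
  by rewrite natr1; exact: truncn_itv.
have inj : {in S &, injective cell}.
  move=> x y xS yS cxy; apply/eqP; apply: contraT => xy.
  have := sepS x y xS yS xy; rewrite ltNge; apply: contraNT => _.
  have -> : v x - v y = \sum_i (c x i - c y i) *: row i B.
    transitivity ((\row_i (c x i - c y i)) *m B); last first.
      by rewrite mulmx_sum_row; apply: eq_bigr => i _; rewrite mxE.
    have -> : \row_i (c x i - c y i) = (v x - v y) *m invmx B.
      apply/rowP => i; rewrite mxE /c -[RHS]/((_ *m _) 0 i).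
      have -> : v x - v y = (v x - v x0) - (v y - v x0) by rewrite opprB addrA subrK.
      by rewrite [in RHS]mulmxBl; move: (_ *m _) (_ *m _) => P Q; rewrite !mxE.
    by rewrite mulmxKV.
  apply: le_trans (is_norm_sum _) _.
  apply: (@le_trans _ _ (\sum_(i < d) (d * q)%:R^-1 * rho)).
    apply: ler_sum => i _; rewrite (is_norm_scale normN).
    have [u ->] := Brow i; apply: ler_pM => //; first exact: is_norm_ge0.
    rewrite -(ler_pM2r dq0) mulVf ?gt_eqF // -[X in _ * X](ger0_norm (ltW dq0)).
    rewrite -normrM ler_norml.
    have := cellP x i xS; have := cellP y i yS; rewrite cxy.
    move=> /andP[? ?] /andP[? ?]; apply/andP; split; lra.
  rewrite sumr_const card_ord -mulr_natl natrM invfM /rho.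
  by rewrite le_eqVlt; apply/orP; left; apply/eqP; field; rewrite !gt_eqF.
rewrite -(card_in_imset inj); apply: leq_trans (max_card _) _.
rewrite card_ffun !card_ord leq_exp2r //.
have : (0 < d * q)%N by rewrite muln_gt0 d0.
rewrite /n; nia.
Qed.

End NormPacking.

(** * Runs of complete linkage *)

Section Runs.
Variables (R : realType) (d : nat) (N : 'rV[R]_d -> R).
Hypothesis normN : is_norm N.
Local Notation V := ('rV[R]_d).
Implicit Types (A B X : {fset V}) (P Q : {fset {fset V}}).

Lemma diam_leP A (t : R) : 0 <= t ->
  reflect {in A &, forall x y, N (x - y) <= t} (diam N A <= t).
Proof.
move=> t0; apply: (iffP idP) => [At x y xA yA|At].
  apply: le_trans At; apply: le_trans (le_bigmax_seq 0 _ _ _ xA isT).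
  exact: (le_bigmax_seq 0 _ _ _ yA isT).
rewrite /diam big_seq; apply: bigmax_le => // x xA.
by rewrite big_seq; apply: bigmax_le => // y yA; apply: At.
Qed.

Lemma diamcost_leP P (t : R) : 0 <= t ->
  reflect {in P, forall A, diam N A <= t} (diamcost N P <= t).
Proof.
move=> t0; apply: (iffP idP) => [Pt A AP|Pt].
  by apply: le_trans Pt; apply: (le_bigmax_seq 0 _ _ _ AP isT).
by rewrite /diamcost big_seq; apply: bigmax_le => // A AP; apply: Pt.
Qed.

Lemma diamcost_ge0 P : 0 <= diamcost N P.
Proof. exact: bigmax_ge_id. Qed.

Definition refines P Q : Prop :=
  {in P, forall A, exists2 B, B \in Q & fsubset A B}.

Lemma refines_diamcost P Q : refines P Q -> diamcost N P <= diamcost N Q.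
Proof.
move=> PQ; apply/diamcost_leP => [|A AP]; first exact: diamcost_ge0.
have [B BQ /fsubsetP AB] := PQ A AP; apply/diam_leP => [|x y xA yA].
  exact: diamcost_ge0.
have := diamcost_leP Q (diamcost_ge0 Q) (lexx _) => /(_ B BQ).
by move/(diam_leP B (diamcost_ge0 Q)); apply; apply: AB.
Qed.

Lemma clustering_cover X k P x : is_clustering X k P ->
  x \in X -> exists2 A, A \in P & x \in A.
Proof.
by case=> <- _ _ _ /bigfcupP[A]; rewrite andbT => AP xA; exists A.
Qed.

Lemma clustering_sub X k P A x : is_clustering X k P ->
  A \in P -> x \in A -> x \in X.
Proof.
by case=> <- _ _ _ AP xA; apply/bigfcupP; exists A => //; rewrite AP.
Qed.

Lemma clustering_inj X k P A B x : is_clustering X k P ->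
  A \in P -> B \in P -> x \in A -> x \in B -> A = B.
Proof.
case=> _ /trivIfsetP triv _ _ AP BP xA xB; apply/eqP; apply: contraT => AB.
by have /fdisjointP/(_ x xA) := triv A B AP BP AB; rewrite xB.
Qed.

Lemma clustering_neq0 X k P A : is_clustering X k P -> A \in P ->
  exists x, x \in A.
Proof.
by case=> _ _ P0 _ AP; apply/fset0Pn; apply: contraNneq P0 => <-.
Qed.

Lemma merge_clustering X i P Q :
  is_clustering X i.+1 P -> merge_step N P Q -> is_clustering X i Q.
Proof.
move=> XP [A [B [AP BP AB _ ->]]].
have [x xA] := clustering_neq0 XP AP; have [y yB] := clustering_neq0 XP BP.
have inQ D : (D \in (A `|` B) |` (P `\` [fset A; B]))%fset =
    (D == A `|` B)%fset || [&& D != A, D != B & D \in P].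
  by rewrite !inE negb_or andbA.
have neq D u : D \in P -> u \in D -> u \notin (A `|` B)%fset ->
    (D != A) && (D != B).
  move=> DP uD; rewrite inE negb_or => /andP[uA uB].
  by apply/andP; split; [apply: contraNneq uA => <-|apply: contraNneq uB => <-].
have disj D u : D \in P -> D != A -> D != B -> u \in D ->
    u \notin (A `|` B)%fset.
  move=> DP DA DB uD; rewrite inE negb_or; apply/andP; split.
    by apply: contra DA => uA; rewrite (clustering_inj XP DP AP uD uA).
  by apply: contra DB => uB; rewrite (clustering_inj XP DP BP uD uB).
split.
- apply/fsetP => u; apply/bigfcupP/idP => [[D]|uX].
    rewrite andbT inQ => /orP[/eqP->|/and3P[_ _ DP]]; last exact: clustering_sub XP DP.
    by rewrite inE => /orP[]; [exact: clustering_sub XP AP|exact: clustering_sub XP BP].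
  have [uAB|uAB] := boolP (u \in (A `|` B)%fset).
    by exists (A `|` B)%fset => //; rewrite andbT inQ eqxx.
  have [D DP uD] := clustering_cover XP uX.
  have /andP[DA DB] := neq D u DP uD uAB.
  by exists D => //; rewrite andbT inQ DA DB DP orbT.
- apply/trivIfsetP => D E; rewrite !inQ.
  case/orP => [/eqP->|/and3P[DA DB DP]] /orP[/eqP->|/and3P[EA EB EP]].
  + by rewrite eqxx.
  + by move=> _; rewrite fdisjoint_sym; apply/fdisjointP => u; apply: disj.
  + by move=> _; apply/fdisjointP => u; apply: disj.
  + by case: XP => _ /trivIfsetP triv _ _; apply: triv.
- rewrite inQ negb_or !negb_and; case: XP => _ _ P0 _; rewrite P0 !orbT andbT.
  by apply/eqP => /fsetP/(_ x); rewrite !inE xA.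
(* The merged cluster is new, since it meets both [A] and [B] and would otherwise equal each; so the
   number of clusters drops by exactly one. *)
- have ABP : (A `|` B)%fset \notin P.
    apply: contraNN AB => ABP; apply/eqP.
    rewrite -(clustering_inj XP ABP AP _ xA) ?inE ?xA //.
    by rewrite (clustering_inj XP ABP BP _ yB) // inE yB orbT.
  have sub : ([fset A; B] `<=` P)%fset.
    by apply/fsubsetP => D; rewrite !inE => /orP[]/eqP->.
  rewrite cardfsU1 in_fsetD (negPf ABP) andbF cardfsDS //.
  have := fsubset_leq_card sub; rewrite cardfs2 AB; case: XP => _ _ _ ->; lia.
Qed.

Lemma merge_refines P Q : merge_step N P Q -> refines P Q.
Proof.
case=> A [B [AP BP AB _ ->]] D DP.
have [->|DA] := eqVneq D A.
  by exists (A `|` B)%fset; [rewrite !inE eqxx | exact: fsubsetUl].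
have [->|DB] := eqVneq D B.
  by exists (A `|` B)%fset; [rewrite !inE eqxx | exact: fsubsetUr].
by exists D => //; rewrite !inE DP (negPf DA) (negPf DB) orbT.
Qed.

(** Only the merged pair can have pushed the cost above [t], and its diameter is minimal among all
    pairs. *)
Lemma merge_stuck P Q (t : R) : 0 <= t -> merge_step N P Q ->
  diamcost N P <= t -> t < diamcost N Q ->
  {in P &, forall A B, A != B -> t < diam N (A `|` B)%fset}.
Proof.
move=> t0 [A [B [AP BP AB ABmin ->]]] Pt; rewrite ltNge => Qt A' B' A'P B'P A'B'.
apply: lt_le_trans (ABmin A' B' A'P B'P A'B'); rewrite ltNge.
apply: contra Qt => ABt; apply/diamcost_leP => // D.
rewrite !inE => /orP[/eqP->//|/andP[_ DP]].
by move/(diamcost_leP P t0): Pt; apply.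
Qed.

Section Run.
Variables (X : {fset V}) (C : nat -> {fset {fset V}}).
Hypothesis run : complete_linkage N X C.
Let n := #|` X|.

Lemma run_clustering i : (1 <= i <= n)%N -> is_clustering X i (C i).
Proof.
case/andP=> i1 iN.
suff main j : (j < n)%N -> is_clustering X (n - j) (C (n - j)).
  by rewrite -(subKn iN); apply: main; lia.
elim: j => [_|j IH jn].
- rewrite subn0; case: run => -> _; split.
  + apply/fsetP => x; apply/bigfcupP/idP => [[A]|xX].
      by rewrite andbT => /imfsetP[/= y yX ->]; rewrite inE => /eqP->.
    by exists [fset x]%fset; rewrite ?inE ?andbT //; apply/imfsetP; exists x.
  + apply/trivIfsetP => _ _ /imfsetP[/= x _ ->] /imfsetP[/= y _ ->] xy.
    rewrite fdisjoint1X inE; apply: contraNneq xy => ->; exact: eqxx.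
  + apply/negP => /imfsetP[/= x _ /fsetP/(_ x)]; rewrite !inE eqxx //.
  + by rewrite card_imfset //; exact: fset1_inj.
have := IH (ltnW jn).
have -> : (n - j = (n - j.+1).+1)%N by lia.
move/merge_clustering; apply; case: run => _; apply; rewrite -/n; lia.
Qed.

Lemma run_refines i j : (1 <= i <= j)%N -> (j <= n)%N -> refines (C j) (C i).
Proof.
case/andP=> i1 ij; rewrite -(subnKC ij); elim: (j - i)%N => [|m IH] jn.
  by rewrite addn0 => A inA; exists A.
move=> A inA; have step : merge_step N (C (i + m).+1) (C (i + m)).
  by case: run => _; apply; rewrite -/n; lia.
rewrite addnS in inA; have [B inB AB] := merge_refines step inA.
have [|D DC BD] := IH _ B inB; first lia.
by exists D => //; apply: fsubset_trans BD.
Qed.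

(** The least index of a clustering of cost at most [t]; list positions count from 0, indices of the
    run from 1. *)
Definition stage (t : R) : nat :=
  (find (fun i => diamcost N (C i) <= t) (iota 1 n)).+1.

Hypothesis X0 : (0 < n)%N.

Lemma diamcost_start : diamcost N (C n) = 0.
Proof.
apply/eqP; rewrite eq_le diamcost_ge0 andbT; case: run => -> _.
apply/diamcost_leP => // _ /imfsetP[/= x _ ->]; apply/diam_leP => // y z.
by rewrite !inE => /eqP-> /eqP->; rewrite subrr is_norm0.
Qed.

Lemma stageP (t : R) : 0 <= t ->
  [/\ (1 <= stage t <= n)%N, diamcost N (C (stage t)) <= t &
    forall i, (1 <= i < stage t)%N -> t < diamcost N (C i)].
Proof.
move=> t0; set p := fun i => diamcost N (C i) <= t.
have hasp : has p (iota 1 n).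
  by apply/hasP; exists n; rewrite ?mem_iota /p ?diamcost_start //; lia.
have fn : (find p (iota 1 n) < n)%N by rewrite -[X in (_ < X)%N](size_iota 1) -has_find.
split=> [|| [//|i] /andP[_ it]].
- by rewrite /stage -/p.
- by have := nth_find 0%N hasp; rewrite nth_iota // add1n.
- have := before_find 0%N (it : i < find p _)%N.
  rewrite nth_iota ?add1n; first by rewrite /p => /negbT; rewrite -ltNge.
  by move: it fn; rewrite /stage -/p; lia.
Qed.

Lemma stage_le (t t' : R) : 0 <= t -> t <= t' -> (stage t' <= stage t)%N.
Proof.
move=> t0 tt'; have [/andP[s1 _] st _] := stageP t0.
have [_ _ min] := stageP (le_trans t0 tt'); rewrite leqNgt; apply/negP => lt.
by have := min (stage t); rewrite s1 lt ltNge (le_trans st tt') => /(_ isT).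
Qed.

Definition run_cl (t : R) (x : X) : {set X} :=
  [set y : X | has (fun A : {fset V} => (val x \in A) && (val y \in A)) (C (stage t))].

Lemma run_clP (t : R) (x y : X) A : 0 <= t -> A \in C (stage t) ->
  val x \in A -> (y \in run_cl t x) = (val y \in A).
Proof.
move=> t0 inA xA; have [/run_clustering XC _ _] := stageP t0.
rewrite inE; apply/hasP/idP => [[B inB /andP[xB yB]]|yA].
  by rewrite (clustering_inj XC inA inB xA xB).
by exists A; rewrite // xA.
Qed.

Lemma run_cover (t : R) (x : X) : 0 <= t ->
  exists2 A, A \in C (stage t) & val x \in A.
Proof.
move=> t0; have [/run_clustering XC _ _] := stageP t0.
exact: (clustering_cover XC (valP x)).
Qed.

Lemma run_linkage : linkage (fun x y : X => N (val x - val y)) run_cl.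
Proof.
split.
- by move=> x; rewrite subrr is_norm0.
- by move=> x y; rewrite -(is_norm_opp normN) opprB.
- move=> y x z; have := is_norm_triangle normN (val x - val y) (val y - val z).
  by rewrite addrA subrK.
- by move=> t x t0; have [A inA xA] := run_cover x t0; rewrite (run_clP _ t0 inA xA).
- move=> t x y t0; have [A inA xA] := run_cover x t0; rewrite (run_clP _ t0 inA xA).
  by move=> yA; apply/setP => z; rewrite (run_clP _ t0 inA xA) (run_clP _ t0 inA yA).
- move=> t x y t0; have [A inA xA] := run_cover x t0; rewrite (run_clP _ t0 inA xA).
  move=> yA; have [_ /(diamcost_leP _ t0)/(_ A inA)/(diam_leP _ t0) At _] := stageP t0.
  exact: At.
- move=> t t' x t0 tt'; have [A inA xA] := run_cover x t0.
  have [/andP[_ sn] _ _] := stageP t0.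
  have [/andP[s1 _] _ _] := stageP (le_trans t0 tt').
  have s12 : (1 <= stage t' <= stage t)%N by rewrite s1 stage_le.
  have [B inB /fsubsetP AB] := run_refines s12 sn inA.
  apply/subsetP => y; rewrite (run_clP _ t0 inA xA).
  by rewrite (run_clP _ (le_trans t0 tt') inB (AB _ xA)); apply: AB.
- move=> t x y t0 xyt; have [A inA xA] := run_cover x t0.
  have [B inB yB] := run_cover y t0.
  suff AB : A = B.
    by apply/setP => z; rewrite (run_clP _ t0 inA xA) (run_clP _ t0 inB) // -AB.
  apply/eqP; apply: contraT => AB.
  have [sn st smin] := stageP t0; have XC := run_clustering sn.
  have At := (diamcost_leP _ t0 st).
  (* At stage 1 there is only one cluster. Otherwise the next merge exceeds cost [t], and
     [merge_stuck] applies to [A] and [B]. *)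
  case E : (stage t) sn => [//|[|i]] /andP[_ sn].
    rewrite E in inA inB XC; case: XC => _ _ _ /eqP/cardfs1P[D CD].
    by move: AB; rewrite CD !inE in inA inB; rewrite (eqP inA) (eqP inB) eqxx.
  have step : merge_step N (C i.+2) (C i.+1) by case: run => _; apply; rewrite -/n; lia.
  rewrite E in inA inB st XC smin.
  have := merge_stuck t0 step st (smin i.+1 (leqnn _)) inA inB AB.
  rewrite ltNge; case/negP; apply/diam_leP => // u v.
  have inX D w : D \in C i.+2 -> w \in D -> w \in X by apply: clustering_sub XC.
  have cross u' v' : u' \in A -> v' \in B -> N (u' - v') <= t.
    move=> uA vB; rewrite -E in inA inB inX.
    apply: (xyt [` inX A u' inA uA]%fset [` inX B v' inB vB]%fset).
      by rewrite (run_clP _ t0 inA xA).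
    by rewrite (run_clP _ t0 inB yB).
  have diamt D w w' : D \in C i.+2 -> w \in D -> w' \in D -> N (w - w') <= t.
    by move=> DC; move/(diamcost_leP _ t0)/(_ D DC)/(diam_leP _ t0): st; apply.
  rewrite !inE => /orP[uA|uB] /orP[vA|vB].
  + exact: (diamt A).
  + exact: cross.
  + by rewrite -(is_norm_opp normN) opprB cross.
  + exact: (diamt B).
Qed.

Lemma stage_le_card (t : R) : 0 <= t -> (stage t <= #|run_cl t @: [set: X]|)%N.
Proof.
move=> t0; have [sn _ _] := stageP t0; have XC := run_clustering sn.
pose f (A : C (stage t)) : {set X} := [set y : X | val y \in val A].
have f_inj : injective f.
  move=> A B fAB; apply/val_inj; have [x xA] := clustering_neq0 XC (valP A).
  have xX := clustering_sub XC (valP A) xA.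
  apply: (clustering_inj XC (valP A) (valP B) xA).
  by move/setP/(_ [` xX]%fset): fAB; rewrite !inE /= xA.
have -> : stage t = #|f @: setT|.
  by rewrite card_imset // cardsT -cardfE; case: XC.
apply/subset_leq_card/subsetP => _ /imsetP[A _ ->].
have [x xA] := clustering_neq0 XC (valP A).
have xX := clustering_sub XC (valP A) xA.
apply/imsetP; exists [` xX]%fset => //; apply/setP => y.
by rewrite inE (@run_clP t [` xX]%fset y _ t0 (valP A) xA).
Qed.

End Run.

End Runs.

(** * The approximation ratio *)

(* With [W = (60 d^2)^d], the bounds [K = 2^(3W)] and [J = 6W + 1] lead to the
   final scale [s = (12 * 2^(9W) + 1) r <= 2^(13W) r]. *)
Definition log2_ratio (d : nat) : nat := (13 * (60 * d ^ 2) ^ d)%N.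

Lemma log2_ratio_gt0 d : (0 < log2_ratio d)%N.
Proof. by rewrite muln_gt0 /= expn_gt0 muln_gt0 expn_gt0; case: d. Qed.

Lemma near_const_le d : (0 < d)%N ->
  (2 ^ d.+1 * shape_const (3 * d) d <= 2 ^ (3 * (60 * d ^ 2) ^ d))%N.
Proof.
move=> d0; set W := ((60 * d ^ 2) ^ d)%N.
have le1 : ((3 * d * (10 * d.+1)) ^ d <= 2 ^ W)%N.
  apply: leq_trans (ltnW (ltn_expl W (isT : 1 < 2)%N)).
  by rewrite /W leq_exp2r // -mulnn; nia.
have le2 : ((3 * d * (8 * d.+1)) ^ d <= W)%N by rewrite /W leq_exp2r // -mulnn; nia.
have le3 : (d.+1 <= W)%N.
  apply: leq_trans (ltn_expl d (isT : 1 < 60)%N) _.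
  by rewrite /W leq_exp2r // leq_pmulr // expn_gt0 d0.
rewrite /shape_const mulnA (_ : 3 * W = W + W + W)%N; last by lia.
by rewrite 2!expnD !leq_mul // leq_exp2l.
Qed.

(** For these [d], [13 <= d ^ d] and [60 * d ^ 2 <= d ^ 3], so [log2_ratio d <= d ^ (4 * d)]. *)
Lemma ln_log2_ratio (R : realType) d : (60 <= d)%N ->
  ln (log2_ratio d)%:R <= 4 * (d%:R * ln (d%:R : R)).
Proof.
move=> d60; have d_gt0 : (0 < d)%N by lia.
have d0 : 0 < d%:R :> R by rewrite ltr0n.
have -> : 4 * (d%:R * ln (d%:R : R)) = ln ((d ^ (4 * d))%:R : R).
  by rewrite natrX lnXn // -[RHS]mulr_natl natrM mulrA.
rewrite ler_ln ?posrE ?ltr0n ?log2_ratio_gt0 ?expn_gt0 ?d_gt0 // ler_nat.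
rewrite /log2_ratio; apply: (@leq_trans (d ^ d * (d ^ 3) ^ d)).
  apply: leq_mul; last by rewrite leq_exp2r // (expnS d 2) leq_mul2r d60 orbT.
  apply: (@leq_trans (d ^ 1)); first by rewrite expn1; lia.
  by rewrite leq_exp2l //; lia.
rewrite -expnM -expnD leq_exp2l; lia.
Qed.

Section Ratio.
Variables (R : realType) (d : nat) (N : 'rV[R]_d -> R).
Hypothesis normN : is_norm N.
Variables (X : {fset 'rV[R]_d}) (C : nat -> {fset {fset 'rV[R]_d}}).
Hypothesis run : complete_linkage N X C.

(** Points of one cluster of [P] are at most [diamcost N P] apart, so [M] meets each cluster at most
    once. *)
Lemma card_separated_le (k : nat) P (M : {set X}) : is_clustering X k P ->
  separated (fun x y : X => N (val x - val y)) (diamcost N P) M ->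
  (#|M| <= k)%N.
Proof.
move=> XP sepM.
have /fin_all_exists[f fP] (x : X) : exists A : P, val x \in val A.
  by have [A AP xA] := clustering_cover XP (valP x); exists [` AP]%fset.
have : {in M &, injective f}.
  move=> x y xM yM fxy; apply/eqP; apply: contraT => xy.
  have := sepM x y xM yM xy; rewrite ltNge; case/negP.
  have /(_ (val (f x)) (valP _)) := diamcost_leP N P (diamcost_ge0 N P) (lexx _).
  move/(diam_leP _ _ (diamcost_ge0 N P)); apply; first exact: fP.
  by rewrite fxy; apply: fP.
move/card_in_imset <-; apply: leq_trans (max_card _) _.
by rewrite -cardfE; case: XP => _ _ _ ->.
Qed.

(** At cost 0 all of [X] would be separated, forcing at least [#|X|] clusters. *)
Lemma diamcost_gt0 k P : is_clustering X k P -> (k < #|` X|)%N ->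
  0 < diamcost N P.
Proof.
move=> XP kX; rewrite lt_neqAle diamcost_ge0 andbT; apply: contraTneq kX => r0.
rewrite -leqNgt cardfE -cardsT; apply: (card_separated_le XP) => x y _ _ xy.
rewrite -r0 lt_neqAle is_norm_ge0 // andbT; apply: contraNneq xy => xy0.
apply/eqP/val_inj/eqP; rewrite -subr_eq0; apply/eqP.
exact: (is_norm_eq0 normN).
Qed.

Lemma run_ratio k : (1 <= k < #|` X|)%N ->
  diamcost N (C k) <= 2 ^+ log2_ratio d * opt N X k.
Proof.
case/andP=> k1 kX; have X0 : (0 < #|` X|)%N by apply: leq_ltn_trans kX.
have kn : (1 <= k <= #|` X|)%N by rewrite k1 ltnW.
have [P [XP -> _]] := opt_min N (run_clustering run kn).
have r0 := diamcost_gt0 XP kX; set r := diamcost N P in r0 *.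
(* In dimension 0 there is only one point. *)
have d0 : (0 < d)%N.
  rewrite lt0n; apply: contraTneq kX => d0; rewrite -leqNgt.
  apply: leq_trans k1; rewrite cardfE; apply/card_le1_eqP => x y _ _.
  by apply/val_inj/rowP => i; have := ltn_ord i; rewrite {2}d0.
pose W := ((60 * d ^ 2) ^ d)%N; pose E := (3 * W)%N.
have L := run_linkage normN run X0.
have near := card_near_clusters L (norm_packing normN (v := fun x : X => val x) d0).
have [M [z [_ sepM zM]]] := exists_net L setT (ltW r0).
have KJ : (2 ^ E * 2 ^ E < 2 ^ (2 * E).+1)%N by rewrite -expnD ltn_exp2l //; lia.
have cardE (s : R) (y : X) : 0 < s ->
    (#|run_cl N C s @: [set x : X | (N (val y - val x) <= s)%R]| <= 2 ^ E)%N.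
  move=> s0; apply: leq_trans (near_const_le d0).
  by apply: near => //; rewrite muln_gt0 d0.
have := card_clusters_le L (expn_gt0 2 E) KJ r0 cardE (fun x => zM x (in_setT x)).
set s := _ + r => le_M.
have sE : s = (12 * 2 ^+ (3 * E) + 1) * r.
  rewrite /s natrX exprS (mulnC 2) (mulnC 3) !exprM.
  by move: (2 ^+ E : R) => e; ring.
have e1 n : 1 <= 2 ^+ n :> R by rewrite exprn_ege1 // ler1n.
have s0 : 0 <= s by rewrite sE mulr_ge0 ?(ltW r0) //; have := e1 (3 * E)%N; lra.
(* At time [s] at most [#|M| <= k] clusters are left, so [C k] refines that stage and costs at most
   [s]. *)
have sk : (stage N X C s <= k)%N.
  apply: leq_trans (stage_le_card normN run X0 s0) (leq_trans le_M _).
  exact: card_separated_le XP sepM.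
have [/andP[s1 _] Cs _] := stageP normN run X0 s0.
have s1k : (1 <= stage N X C s <= k)%N by rewrite s1 sk.
apply: le_trans (refines_diamcost N (run_refines run s1k (ltnW kX))) _.
apply: le_trans Cs _; rewrite sE ler_pM2r //.
have W0 : (0 < W)%N by rewrite expn_gt0 muln_gt0 expn_gt0 d0.
apply: (@le_trans _ _ (2 ^+ (3 * E + 4))).
  by rewrite exprD; have := e1 (3 * E)%N; lra.
by rewrite ler_eXn2l ?ltr1n // /log2_ratio -/W /E; lia.
Qed.

End Ratio.

Local Open Scope classical_set_scope.
Theorem theorem3 (R : realType) :
  exists c : nat -> R,
    (exists g : nat -> R,
       g =O_\oo (fun d : nat => d%:R * ln (d%:R : R)) /\
       forall d : nat, c d = 2 `^ (2 `^ g d)) /\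
    forall (d : nat) (N : 'rV[R]_d -> R), is_norm N ->
    forall (X : {fset 'rV[R]_d}) (C : nat -> {fset {fset 'rV[R]_d}}),
      complete_linkage N X C ->
    forall k : nat, (1 <= k <= #|` X|)%N ->
      diamcost N (C k) <= c d * (1 + ln k%:R) * opt N X k.
Proof.
have ln2 : 0 < ln 2 :> R by rewrite ln_gt0 // ltr1n.
pose g d : R := ln (log2_ratio d)%:R / ln 2.
have gE d : 2 `^ g d = (log2_ratio d)%:R.
  by rewrite /powR pnatr_eq0 /= /g divfK ?gt_eqF // lnK // posrE ltr0n log2_ratio_gt0.
exists (fun d => 2 ^+ log2_ratio d); split.
  exists g; split=> [|d]; last by rewrite gE powR_mulrn.
  apply/eqO_exP; exists (4 / ln 2); first by rewrite divr_gt0.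
  near=> d; have d60 : (60 <= d)%N by near: d; exact: nbhs_infty_ge.
  have d1 : 1 <= d%:R :> R by rewrite ler1n; lia.
  rewrite !ger0_norm.
  - by rewrite /g mulrAC ler_pM2r ?invr_gt0 // ln_log2_ratio.
  - by rewrite mulr_ge0 ?ler0n // ln_ge0.
  - by rewrite divr_ge0 ?(ltW ln2) // ln_ge0 // ler1n log2_ratio_gt0.
move=> d N normN X C run k /andP[k1 kX].
have kn : (1 <= k <= #|` X|)%N by rewrite k1.
have [P [_ optE _]] := opt_min N (run_clustering run kn).
have opt0 : 0 <= opt N X k by rewrite optE diamcost_ge0.
have ln0 : 0 <= ln (k%:R : R) by rewrite ln_ge0 // ler1n.
have c0 : 0 <= 2 ^+ log2_ratio d :> R by rewrite exprn_ge0.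
(* For [k < #|X|] the ratio independent of [k] suffices, as [1 + ln k >= 1]. For [k = #|X|] the
   optimum, used as scale there, vanishes, but the run consists of singletons and costs 0. *)
have [kX'|Xk] := ltnP k #|` X|.
  apply: le_trans (run_ratio normN run _) _; first by rewrite k1.
  by rewrite ler_wpM2r // ler_peMr // lerDl.
have -> : k = #|` X| by apply/eqP; rewrite eqn_leq kX.
rewrite (diamcost_start normN run) !mulr_ge0 ?addr_ge0 //.
  by rewrite ln_ge0 // ler1n (leq_trans k1).
have <- : k = #|` X| by apply/eqP; rewrite eqn_leq kX.
by [].
Unshelve. all: by end_near.
Qed.
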